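(* Let $\mathbb{X}$ be an update restriction category with update operator $\diamond$. Then $\mathbb{X}$ is an override restriction category, with the same underlying restriction structure and with override operator $\triangleright$ defined by $f\triangleright g=(g\diamond f)\vee f$ for $f,g\in\mathbb{X}(A,B)$. Moreover, the induced update operator of this override operator is precisely $\diamond$, that is, $\overline{f}(g\triangleright f)=f\diamond g$ for all $f,g\in\mathbb{X}(A,B)$.
   Context: Composition is written diagrammatically: for $f:A\to B$ and $g:B\to C$, $fg:A\to C$ is $f$ followed by $g$. Composition binds more tightly than all other binary operations. A restriction category is a category $\mathbb{X}$ equipped with operations $\overline{(-)}:\mathbb{X}(A,B)\to\mathbb{X}(A,A)$ for all objects $A,B$ such that: [R.1] $\overline{f}f=f$ for $f\in\mathbb{X}(A,B)$; [R.2] $\overline{f}\,\overline{g}=\overline{g}\,\overline{f}$ for $f\in\mathbb{X}(A,B)$, $g\in\mathbb{X}(A,C)$; [R.3] $\overline{\overline{f}g}=\overline{f}\,\overline{g}$ for $f\in\mathbb{X}(A,B)$, $g\in\mathbb{X}(A,C)$; [R.4] $f\overline{g}=\overline{fg}f$ for $f\in\mathbb{X}(A,B)$, $g\in\mathbb{X}(B,C)$. For $f,g\in\mathbb{X}(A,B)$: $f\le g$ means $\overline{f}g=f$ (this is a partial order on each homset); $f\smile g$ ($f$ and $g$ are compatible) means $\overline{g}f=\overline{f}g$. A restriction category has binary joins if for all $f,g\in\mathbb{X}(A,B)$ with $f\smile g$ there is a map $f\vee g\in\mathbb{X}(A,B)$ such that: [J.1] $f\le f\vee g$ and $g\le f\vee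 g$; [J.2] for any $h\in\mathbb{X}(A,B)$, if $f\le h$ and $g\le h$ then $f\vee g\le h$; [J.3] for any $k\in\mathbb{X}(A',A)$, $k(f\vee g)=kf\vee kg$. Joins are unique when they exist. An override restriction category is a restriction category $\mathbb{X}$ with binary operations $\triangleright:\mathbb{X}(A,B)\times\mathbb{X}(A,B)\to\mathbb{X}(A,B)$ for all objects $A,B$ (an override operator) such that: (1) $(f\triangleright g)\triangleright h=f\triangleright(g\triangleright h)$ for $f,g,h\in\mathbb{X}(A,B)$; (2) $f\triangleright\overline{f}g=f$ for $f,g\in\mathbb{X}(A,B)$; (3) $\overline{g}f\triangleright f=f$ for $f\in\mathbb{X}(A,B)$, $g\in\mathbb{X}(A,C)$; (4) $f(g\triangleright h)=fg\triangleright fh$ for $f\in\mathbb{X}(A,B)$, $g,h\in\mathbb{X}(B,C)$; (5) $\overline{f\triangleright g}\,h=\overline{f}h\triangleright\overline{g}h$ for $f,g\in\mathbb{X}(A,C)$, $h\in\mathbb{X}(A,B)$. The induced update operator of an override operator $\triangleright$ is the operation $(f,g)\mapsto\overline{f}(g\triangleright f)$. An update restriction category is a restriction category $\mathbb{X}$ that has binary joins together with binary operations $\diamond:\mathbb{X}(A,B)\times\mathbb{X}(A,B)\to\mathbb{X}(A,B)$ for all objects $A,B$ (an update operator) such that: (U1) $f(g\diamond h)=fg\diamond fh$ for $f\in\mathbb{X}(A,B)$, $g,h\in\mathbb{X}(B,C)$; (U2) $\overline{f\diamond g}=\overline{f}$ for $f,g\in\mathbb{X}(A,B)$; (U3) $\overline{f}g\diamond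 f=\overline{g}f$ for $f,g\in\mathbb{X}(A,B)$; (U4) $\overline{g}h\diamond\overline{f}h=\overline{g}h$ for $f\in\mathbb{X}(A,B)$, $g\in\mathbb{X}(A,C)$, $h\in\mathbb{X}(A,D)$; (U5) $(((h\diamond g)\vee g)\diamond f)\vee f=(h\diamond((g\diamond f)\vee f))\vee((g\diamond f)\vee f)$ for $f,g,h\in\mathbb{X}(A,B)$. (Axioms (U1)-(U3) imply $(g\diamond f)\smile f$ for all parallel $f,g$, so the joins in (U5) and in the formula $(g\diamond f)\vee f$ are defined.) *)

(* Defs.v *)
Set Implicit Arguments.
Unset Strict Implicit.
Unset Printing Implicit Defensive.

Record category := Category {
  obj :> Type;
  hom : obj -> obj -> Type;
  idm : forall A : obj, hom A A;
  cmp : forall A B C : obj, hom A B -> hom B C -> hom A C;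
  cmp_idl : forall (A B : obj) (f : hom A B), cmp (idm A) f = f;
  cmp_idr : forall (A B : obj) (f : hom A B), cmp f (idm B) = f;
  cmpA : forall (A B C D : obj) (f : hom A B) (g : hom B C) (h : hom C D),
    cmp f (cmp g h) = cmp (cmp f g) h
}.

Coercion hom : category >-> Funclass.
Arguments hom : clear implicits.
Arguments idm {c} A.
Arguments cmp {c A B C} f g.

(* Diagrammatic order: f ;; g is f followed by g. *)
Notation "f ;; g" := (cmp f g) (at level 40, left associativity).

Record restrictionCategory := RestrictionCategory {
  rcat :> category;
  rst : forall A B : rcat, rcat A B -> rcat A A;
  rst_R1 : forall (A B : rcat) (f : rcat A B), rst f ;; f = f;
  rst_R2 : forall (A B C : rcat) (f : rcat A B) (g : rcat A C),
    rst f ;; rst g = rst g ;; rst f;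
  rst_R3 : forall (A B C : rcat) (f : rcat A B) (g : rcat A C),
    rst (rst f ;; g) = rst f ;; rst g;
  rst_R4 : forall (A B C : rcat) (f : rcat A B) (g : rcat B C),
    f ;; rst g = rst (f ;; g) ;; f
}.

Arguments rst {r A B} f.

Definition rle (X : restrictionCategory) (A B : X) (f g : X A B) : Prop :=
  rst f ;; g = f.

Definition compatible (X : restrictionCategory) (A B : X) (f g : X A B) : Prop :=
  rst g ;; f = rst f ;; g.

Lemma compatible_cmp (X : restrictionCategory) (A' A B : X) (k : X A' A)
    (f g : X A B) :
  compatible f g -> compatible (k ;; f) (k ;; g).
Proof.
unfold compatible; intro c.
now rewrite !cmpA, <- !rst_R4, <- !cmpA, c.
Qed.

(* The join is a partial operation, so it takes a proof of compatibility; by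
   J1 and J2 its value does not depend on that proof. *)
Record binaryJoins (X : restrictionCategory) := BinaryJoins {
  join : forall (A B : X) (f g : X A B), compatible f g -> X A B;
  join_J1 : forall (A B : X) (f g : X A B) (c : compatible f g),
    rle f (join c) /\ rle g (join c);
  join_J2 : forall (A B : X) (f g : X A B) (c : compatible f g) (h : X A B),
    rle f h -> rle g h -> rle (join c) h;
  join_J3 : forall (A' A B : X) (k : X A' A) (f g : X A B)
    (c : compatible f g), k ;; join c = join (compatible_cmp k c)
}.

Arguments join {X} b {A B} f g c.

Notation "f \v[ J , c ] g" := (join J f g c)
  (at level 50, left associativity, format "f  \v[ J ,  c ]  g").

Definition homOperation (X : restrictionCategory) : Type :=
  forall A B : X, X A B -> X A B -> X A B.

Notation "f <[ op ]> g" := (op _ _ f g)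
  (at level 50, left associativity, only parsing).

Record isOverride (X : restrictionCategory) (ovr : homOperation X) : Prop :=
  IsOverride {
  ovrA : forall (A B : X) (f g h : X A B),
    (f <[ovr]> g) <[ovr]> h = f <[ovr]> (g <[ovr]> h);
  ovr_rstr : forall (A B : X) (f g : X A B), f <[ovr]> (rst f ;; g) = f;
  ovr_rstl : forall (A B C : X) (f : X A B) (g : X A C),
    (rst g ;; f) <[ovr]> f = f;
  cmp_ovr : forall (A B C : X) (f : X A B) (g h : X B C),
    f ;; (g <[ovr]> h) = (f ;; g) <[ovr]> (f ;; h);
  rst_ovr : forall (A B C : X) (f g : X A C) (h : X A B),
    rst (f <[ovr]> g) ;; h = (rst f ;; h) <[ovr]> (rst g ;; h)
}.

Definition inducedUpdate (X : restrictionCategory) (ovr : homOperation X) :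
    homOperation X :=
  fun A B f g => rst f ;; (g <[ovr]> f).

Record isPreUpdate (X : restrictionCategory) (upd : homOperation X) : Prop :=
  IsPreUpdate {
  upd_U1 : forall (A B C : X) (f : X A B) (g h : X B C),
    f ;; (g <[upd]> h) = (f ;; g) <[upd]> (f ;; h);
  upd_U2 : forall (A B : X) (f g : X A B), rst (f <[upd]> g) = rst f;
  upd_U3 : forall (A B : X) (f g : X A B),
    (rst f ;; g) <[upd]> f = rst g ;; f;
  upd_U4 : forall (A B C D : X) (f : X A B) (g : X A C) (h : X A D),
    (rst g ;; h) <[upd]> (rst f ;; h) = rst g ;; h
}.

Lemma upd_compatible (X : restrictionCategory) (upd : homOperation X) :
  isPreUpdate upd ->
  forall (A B : X) (g f : X A B), compatible (g <[upd]> f) f.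
Proof.
intros U A B g f; unfold compatible.
now rewrite (upd_U1 U), rst_R1, (upd_U3 U), (upd_U2 U).
Qed.

(* The joins in U5 are defined because of U1-U3. *)
Record isUpdate (X : restrictionCategory) (J : binaryJoins X)
    (upd : homOperation X) : Prop := IsUpdate {
  upd_pre :> isPreUpdate upd;
  upd_U5 : let c := upd_compatible upd_pre in
    forall (A B : X) (f g h : X A B),
    (((h <[upd]> g) \v[J, c A B h g] g) <[upd]> f) \v[J, c A B _ f] f
    = (h <[upd]> ((g <[upd]> f) \v[J, c A B g f] f))
        \v[J, c A B h _] ((g <[upd]> f) \v[J, c A B g f] f)
}.

Record updateRestrictionCategory := UpdateRestrictionCategory {
  urcat :> restrictionCategory;
  urjoins : binaryJoins urcat;
  upd : homOperation urcat;
  updP : isUpdate urjoins upd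
}.

Arguments urjoins : clear implicits.
Arguments upd {u A B} f g.

Lemma compatible_upd (X : updateRestrictionCategory) (A B : X) (g f : X A B) :
  compatible (upd g f) f.
Proof. exact (upd_compatible (updP X) g f). Qed.

(* Main.v *)
(* Joins are unique, so [ovr f g] may be computed with any compatibility proof.
   Override associativity is then U5 read from right to left.  The one property
   of joins that is not immediate is that [rst (f \/ g) ;; h] is the join of
   [rst f ;; h] and [rst g ;; h]; together with U2 and U4 it gives the last
   override axiom. *)
Require Import Defs.

Set Implicit Arguments.
Unset Strict Implicit.
Unset Printing Implicit Defensive.

Section RestrictionCategory.
Variable X : restrictionCategory.

Lemma rst_idem (A B : X) (f : X A B) : rst f ;; rst f = rst f.
Proof. now rewrite <- rst_R3, rst_R1. Qed.

Lemma rle_refl (A B : X) (f : X A B) : rle f f.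
Proof. exact (rst_R1 f). Qed.

Lemma rle_trans (A B : X) (f g h : X A B) : rle f g -> rle g h -> rle f h.
Proof.
unfold rle; intros fg gh.
now rewrite <- fg, rst_R3, <- cmpA, gh.
Qed.

Lemma rle_antisym (A B : X) (f g : X A B) : rle f g -> rle g f -> f = g.
Proof.
unfold rle; intros fg gf.
transitivity (rst f ;; rst g ;; f).
- now rewrite <- cmpA, gf, fg.
- now rewrite rst_R2, <- cmpA, rst_R1, gf.
Qed.

Lemma rle_rstl (A B C : X) (f : X A B) (g : X A C) : rle (rst g ;; f) f.
Proof. unfold rle; now rewrite rst_R3, <- cmpA, rst_R1. Qed.

Lemma rst_rle (A B : X) (f g : X A B) : rle f g -> rst f ;; rst g = rst f.
Proof. unfold rle; intro fg; now rewrite <- rst_R3, fg. Qed.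

Lemma rst_cmp_rle (A B C : X) (f g : X A B) (h : X A C) :
  rle f g -> rle (rst f ;; h) (rst g ;; h).
Proof.
intro fg; unfold rle.
now rewrite rst_R3, (rst_R2 f h), <- cmpA, (cmpA (rst f)), (rst_rle fg),
  cmpA, (rst_R2 h f), <- cmpA, rst_R1.
Qed.

Lemma rle_cmp_rst (A B C : X) (f g : X A B) (k : X A C) :
  rst f ;; rst k = rst f -> rle f g -> rle f (rst k ;; g).
Proof. unfold rle; intros fk fg; now rewrite cmpA, fk. Qed.

Section Joins.
Variable J : binaryJoins X.

Lemma rle_joinl (A B : X) (f g : X A B) (c : compatible f g) :
  rle f (join J f g c).
Proof. exact (proj1 (join_J1 J c)). Qed.

Lemma rle_joinr (A B : X) (f g : X A B) (c : compatible f g) :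
  rle g (join J f g c).
Proof. exact (proj2 (join_J1 J c)). Qed.

(** A compatibility proof depends on both maps, so rewriting inside [join] is blocked. Uniqueness
    from J1, J2 and antisymmetry replaces it, with no appeal to proof irrelevance. *)
Lemma join_congr (A B : X) (f f' g g' : X A B)
    (c : compatible f g) (c' : compatible f' g') :
  f = f' -> g = g' -> join J f g c = join J f' g' c'.
Proof.
intros ef eg; subst f' g'.
apply rle_antisym; apply join_J2; (apply rle_joinl || apply rle_joinr).
Qed.

Lemma join_r (A B : X) (f g : X A B) (c : compatible f g) :
  rle f g -> join J f g c = g.
Proof.
intro fg; apply rle_antisym; [apply join_J2 | apply rle_joinr].
- exact fg.
- apply rle_refl.
Qed.

Lemma join_l (A B : X) (f g : X A B) (c : compatible f g) :
  rle g f -> join J f g c = f.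
Proof.
intro gf; apply rle_antisym; [apply join_J2 | apply rle_joinl].
- apply rle_refl.
- exact gf.
Qed.

Lemma rst_join_cmp (A B C : X) (f g : X A B) (c : compatible f g)
    (h : X A C) (d : compatible (rst f ;; h) (rst g ;; h)) :
  rst (join J f g c) ;; h = join J (rst f ;; h) (rst g ;; h) d.
Proof.
set (j := join J f g c); set (m := join J (rst f ;; h) (rst g ;; h) d).
assert (mh : rle m h) by (apply join_J2; apply rle_rstl).
(* It suffices that [h] restricted to the domain of [j] is defined only where
   [m] is, and this follows from J3 applied to [rst h ;; j]. *)
assert (bound : forall k : X A B, rle k j -> rle (rst k ;; h) m ->
    rle (rst h ;; k) (rst m ;; j)).
{ intros k kj km; apply rle_cmp_rst.
  - rewrite rst_R3, (rst_R2 h k), <- rst_R3; exact (rst_rle km).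
  - exact (rle_trans (rle_rstl k h) kj). }
assert (hjm : rle (rst h ;; j) (rst m ;; j)).
{ unfold j at 1; rewrite join_J3; apply join_J2; apply bound.
  - apply rle_joinl.
  - apply rle_joinl.
  - apply rle_joinr.
  - apply rle_joinr. }
apply rle_antisym.
(* On restrictions, [hjm] says that [h] and [j] are both defined only where [m] is. Since [m] lies
   below [h], it agrees with [h] there. *)
- assert (e := rst_rle hjm).
  rewrite !rst_R3, (rst_R2 m j), !cmpA, <- (cmpA _ (rst j) (rst j)), rst_idem
    in e.
  unfold rle in mh |- *.
  rewrite <- mh, rst_R3, (rst_R2 j h), cmpA, e, (rst_R2 h j), <- cmpA.
  now rewrite rst_R1.
- apply join_J2; apply rst_cmp_rle.
  + apply rle_joinl.
  + apply rle_joinr.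
Qed.

End Joins.
End RestrictionCategory.

Section Update.
Variable X : updateRestrictionCategory.

Let pre : isPreUpdate (@upd X) := upd_pre (updP X).

Lemma upd_rstr (A B C : X) (f : X A B) (g : X A C) : upd f (rst g ;; f) = f.
Proof.
assert (e := upd_U4 pre g f f).
now rewrite rst_R1 in e.
Qed.

Lemma rst_upd (A B : X) (f g : X A B) : rst f ;; upd f g = upd f g.
Proof.
assert (e := rst_R1 (upd f g)).
now rewrite (upd_U2 pre) in e.
Qed.

(** By U2, the compatibility of [upd f g] with [g] reads [rst g ;; upd f g = rst f ;; g]: an update
    takes the value of [g] wherever both maps are defined. This absorbs the second term of the join
    in the induced update. *)
Lemma rle_rst_upd (A B : X) (f g : X A B) : rle (rst f ;; g) (upd f g).
Proof.
assert (c := compatible_upd f g); unfold compatible in c.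
rewrite (upd_U2 pre) in c.
unfold rle.
now rewrite rst_R3, <- cmpA, c, cmpA, rst_idem.
Qed.

End Update.

Theorem proposition32 (X : updateRestrictionCategory) :
  let ovr : homOperation X := fun A B f g =>
    (upd g f) \v[urjoins X, compatible_upd g f] f in
  isOverride ovr /\
  (forall (A B : X) (f g : X A B), inducedUpdate ovr f g = upd f g).
Proof.
assert (U := upd_pre (updP X)).
intro ovr; split; [split |]; unfold ovr.
- intros A B f g h; symmetry.
  (* U5 carries its own compatibility proofs, not convertible to the opaque [compatible_upd]. The
     outer legs exchange them, including those nested inside [upd]. *)
  etransitivity; [etransitivity; [| exact (upd_U5 (updP X) f g h)] |];
    apply join_congr; try reflexivity; try (apply join_congr; reflexivity);
    apply (f_equal2 (@upd X A B)); try reflexivity; apply join_congr; reflexivity.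
- intros A B f g; apply join_r.
  rewrite (upd_U3 U); apply rle_rstl.
- intros A B C f g.
  rewrite join_l; rewrite upd_rstr.
  + reflexivity.
  + apply rle_rstl.
- intros A B C f g h.
  rewrite join_J3; apply join_congr; [apply (upd_U1 U) | reflexivity].
- intros A B C f g h.
  (* Any two restrictions of the same [h] are compatible, because restriction idempotents
     commute. *)
  assert (d : compatible (rst (upd g f) ;; h) (rst f ;; h)).
  { unfold compatible; rewrite !rst_R3, !cmpA.
    rewrite <- !cmpA, !(cmpA (rst h)), !(rst_R2 h), <- !cmpA, rst_R1, !cmpA.
    now rewrite (rst_R2 f). }
  rewrite (rst_join_cmp (urjoins X) (compatible_upd g f) d).
  apply join_congr; [| reflexivity].
  now rewrite (upd_U4 U), (upd_U2 U).
- intros A B f g; unfold inducedUpdate.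
  rewrite join_J3, join_l; rewrite rst_upd; [reflexivity | apply rle_rst_upd].
Qed.
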